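(* Let $\mathcal{G}$ be a graph and $0<\epsilon<1/4$. (1) If $\operatorname{Ldim}(\mathcal{G})=\ell<\infty$ and $\epsilon<1/2^{\ell+1}$, then $\operatorname{Ldim}(\mathcal{G})=\operatorname{Ldim}(\mathcal{G}_\infty(\epsilon))=\ell$. (2) If in addition $\epsilon<1/2^{\ell+2}$, then $\operatorname{Thr}(\mathcal{G})=\operatorname{Thr}(\mathcal{G}_\infty(\epsilon))$. (3) If $\operatorname{VC}(\mathcal{G})=d<\infty$ and $\epsilon<1/2^{d+1}$, then $\operatorname{VC}(\mathcal{G})=\operatorname{VC}(\mathcal{G}_\infty(\epsilon))$.
   Context: Graphs $\mathcal{G}=(V,E)$ have a symmetric edge relation, possibly infinite vertex set, and self-loops are allowed; $v\sim w$ means $(v,w)\in E$. Throughout $0<\epsilon<1/4$. The dimensions of a graph are those of the hypothesis class on $V$ consisting of the characteristic functions of neighborhoods $N(v)=\{w:(v,w)\in E\}$, $v\in V$. Thus $\operatorname{Ldim}(\mathcal{G})$ is the greatest $m$ (or $\infty$) for which there is a full binary tree of height $m$ with internal nodes labelled by vertices such that for every branch $\langle(x_i,y_i):1\le i\le m\rangle$ ($x_i$ the node label, $y_i=1$ for going right, $0$ for left) there is $v\in V$ with $v\sim x_i\iff y_i=1$ for all $i$; $\operatorname{Thr}(\mathcal{G})$ is the greatest $m$ (or $\infty$) for which there are vertices $x_1,\dots,x_m$, $h_1,\dots,h_m$ with $h_i\sim x_j$ iff $i<j$; $\operatorname{VC}(\mathcal{G})$ is the VC dimension of the family of neighborhoods.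 A weighted $\epsilon$-good set of $\mathcal{G}$ is a finite set $A=\{(v_i,\gamma_i):i<k\}$ with $v_i\in V$ distinct, $\gamma_i\in(0,1]$, $\sum\gamma_i=1$, such that for each $v\in V$ either $\sum\{\gamma_i:v_i\sim v\}\ge1-\epsilon$ (write $\mathbf{t}(A,v)=1$) or $\sum\{\gamma_i:v_i\not\sim v\}\ge1-\epsilon$ (write $\mathbf{t}(A,v)=0$). An $\epsilon$-vertex (weighted $\epsilon$-excellent set) is a weighted $\epsilon$-good set $B=\{(v_i,\gamma_i):i<k\}$ such that for every weighted $\epsilon$-good set $A$ of $\mathcal{G}$ either $\sum\{\gamma_i:\mathbf{t}(A,v_i)=1\}\ge1-\epsilon$ (write $\mathbf{t}(B,A)=1$) or $\sum\{\gamma_i:\mathbf{t}(A,v_i)=0\}\ge1-\epsilon$ (write $\mathbf{t}(B,A)=0$). For $\epsilon<1/4$ and $\epsilon$-vertices $A,B$ one has $\mathbf{t}(A,B)=\mathbf{t}(B,A)$; write $A\sim_\epsilon B$ if this value is $1$. A vertex $v$ is identified with the $\epsilon$-vertex $\{(v,1)\}$. For an $\epsilon$-vertex $A$, $\mathbf{t}_A$ is the function on the set of $\epsilon$-vertices given by $B\mapsto\mathbf{t}(A,B)$. $\epsilon$-saturation: $\mathcal{G}_0(\epsilon)=\mathcal{G}$. Given $\mathcal{G}_n(\epsilon)=(V_n,E_n)$, set $V_{n+1}=V_n\cup W$, where $W$ is a set of $\epsilon$-vertices of $\mathcal{G}_n(\epsilon)$ (added as new vertices) such that for every $\epsilon$-vertex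 $A$ of $\mathcal{G}_n(\epsilon)$ with $|A|>1$ there is precisely one $\epsilon$-vertex $B$ of $\mathcal{G}_n(\epsilon)$ with $B\in W$ and $\mathbf{t}_B=\mathbf{t}_A$; on $V_n\times V_n$, $E_{n+1}$ agrees with $E_n$, and for other pairs $(v,w)\in V_{n+1}\times V_{n+1}$, $(v,w)\in E_{n+1}$ iff $v\sim_\epsilon w$ (computed in $\mathcal{G}_n(\epsilon)$). Finally $\mathcal{G}_\infty(\epsilon)=(V_\infty,E_\infty)$ with $V_\infty=\bigcup_nV_n$, $E_\infty=\bigcup_nE_n$. *)

(* Defs.v *)
From HB Require Import structures.
From mathcomp Require Import all_boot all_order all_algebra finmap.
From mathcomp Require Import all_classical all_reals ereal.
From mathcomp Require Import ring lra.

Set Implicit Arguments.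
Unset Strict Implicit.
Unset Printing Implicit Defensive.

Import Order.TTheory GRing.Theory Num.Theory.

Local Open Scope classical_set_scope.
Local Open Scope ring_scope.

(* Self-loops are allowed, so [adj] is not required to be irreflexive. *)
Record graph := Graph {
  vertex :> choiceType;
  adj : rel vertex;
  adj_sym : symmetric adj
}.

Section Dimensions.
Variables (R : realType) (G : graph).

(* The greatest element of [P], or +oo if [P] is unbounded (and -oo if [P] is
   empty, which for the sets below happens only when [G] has no vertex). *)
Definition greatest (P : set nat) : \bar R :=
  ereal_sup [set (m%:R)%:E | m in P].

(* The internal nodes of the full binary tree of height [m] are the boolean
   sequences of size < [m] (the directions followed from the root, [true] being
   right) and [x] gives their labels; only its values at those are used.  The
   (i+1)-st internal node on the branch [y] is [take i y]. *)
Definition littlestone_tree (m : nat) (x : seq bool -> G) : Prop :=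
  forall y : m.-tuple bool, exists v : G,
    forall i : 'I_m, adj v (x (take i y)) = tnth y i.

Definition Ldim : \bar R :=
  greatest [set m | exists x, @littlestone_tree m x].

Definition Thr : \bar R :=
  greatest [set m | exists x h : 'I_m -> G,
    forall i j : 'I_m, adj (h i) (x j) = (i < j)%N].

Definition nbhd (v : G) : set G := [set w | adj v w].

Definition shatters (F : set (set G)) (S : {fset G}) : Prop :=
  forall T : {fset G}, (T `<=` S)%fset ->
    exists2 N, F N & [set` S] `&` N = [set` T].

Definition VC : \bar R :=
  greatest [set m | exists2 S : {fset G}, #|` S|%fset = m &
                                          shatters (range nbhd) S].

End Dimensions.

Section WeightedSets.
Variables (R : realType) (eps : R).

(* [A] stands for the set {(v, A v) : v \in finsupp A}. *)
Definition wset (G : graph) := {fsfun G -> R with 0}.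

Section Fixed.
Variable G : graph.
Implicit Types (A B C : wset G) (v : G) (b : bool).

Definition weighted A : Prop :=
  (forall v, v \in finsupp A -> 0 < A v <= 1) /\
  \sum_(v <- finsupp A) A v = 1.

(* t(A, v) = b *)
Definition tv A v b : bool :=
  1 - eps <= \sum_(u <- finsupp A | adj u v == b) A u.

Definition good A : Prop :=
  weighted A /\ forall v, tv A v true \/ tv A v false.

(* t(B, A) = b *)
Definition ts B A b : bool :=
  1 - eps <= \sum_(v <- finsupp B | tv A v b) B v.

Definition eps_vertex B : Prop :=
  good B /\ forall A, good A -> ts B A true \/ ts B A false.

(* t_A = t_B *)
Definition same_t A B : Prop :=
  forall C, eps_vertex C -> forall b, ts A C b = ts B C b.

Definition point v : wset G := [fsfun x in [fset v]%fset => 1 | 0].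

(* The possible sets W of new vertices of a saturation step.  One-point members
   {(v, 1)} are not excluded; as W is added disjointly, they become twins of
   the vertex v. *)
Record representatives := Representatives {
  rep_set :> set (wset G);
  rep_eps_vertex : forall B, rep_set B -> eps_vertex B;
  rep_unique : forall A, eps_vertex A -> (1 < #|` finsupp A|%fset)%N ->
    exists! B, rep_set B /\ same_t B A
}.

Lemma weighted_ge0 A v : weighted A -> 0 <= A v.
Proof.
case=> A0 _; have [/A0/andP[/ltW]//|vA] := boolP (v \in finsupp A).
by rewrite fsfun_dflt.
Qed.

Lemma finsupp_point v : finsupp (point v) = [fset v]%fset.
Proof.
apply/fsetP => u; rewrite mem_finsupp fsfunE inE.
by case: (u == v); rewrite ?oner_eq0 ?eqxx.
Qed.

Lemma pointE v : point v v = 1.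
Proof. by rewrite fsfunE inE eqxx. Qed.

Lemma point_eps_vertex v : 0 < eps -> eps_vertex (point v).
Proof.
move=> e0.
have sum1 (P : pred G) : P v ->
    1 - eps <= \sum_(u <- finsupp (point v) | P u) point v u.
  move=> Pv; rewrite big_mkcond finsupp_point big_seq_fset1 Pv pointE; lra.
split; last first.
  by move=> A [_ /(_ v)[] tA]; [left|right]; exact: (sum1 (fun u => tv A u _)).
split; last first.
  move=> w; case vw : (adj v w); [left|right];
    by apply: (sum1 (fun u => adj u w == _)); rewrite vw.
split; last by rewrite finsupp_point big_seq_fset1 pointE.
by move=> u; rewrite finsupp_point inE => /eqP->; rewrite pointE ltr01 lexx.
Qed.

Lemma representatives_exist : inhabited representatives.
Proof.
pose cand A := [set B |
  [/\ eps_vertex B, (1 < #|` finsupp B|%fset)%N & same_t B A]].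
pose f A := xget ([fsfun] : wset G) (cand A).
have fP A : eps_vertex A -> (1 < #|` finsupp A|%fset)%N -> cand A (f A).
  by move=> eA A1; apply: (@xgetPex _ ([fsfun] : wset G) (cand A)); exists A.
have fE A B : same_t A B -> f A = f B.
  move=> AB; congr xget; apply/seteqP; split=> C [eC C1 sC]; split=> // D eD b.
    by rewrite sC// AB.
  by rewrite sC// AB.
constructor.
apply: (@Representatives
  [set B | exists A, [/\ eps_vertex A, (1 < #|` finsupp A|%fset)%N & B = f A]]).
  by move=> B [A [eA A1 ->]]; have [] := fP A eA A1.
move=> A eA A1; exists (f A); split.
  by split; [exists A|have [] := fP A eA A1].
move=> _ [[C [eC C1 ->]] sCA]; apply: fE => D eD b.
by have [_ _ sfC] := fP C eC C1; rewrite -(sCA D eD b) sfC.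
Qed.

Hypothesis eps_bounds : 0 < eps < 1 / 4.

Let edge_weight A B b : R :=
  \sum_(u <- finsupp A) \sum_(v <- finsupp B)
    (if adj u v == b then A u * B v else 0).

Let edge_weightC A B b : edge_weight A B b = edge_weight B A b.
Proof.
rewrite /edge_weight exchange_big; apply: eq_bigr => v _; apply: eq_bigr => u _.
by rewrite adj_sym mulrC.
Qed.

Let edge_weight_sum A B : weighted A -> weighted B ->
  edge_weight A B true + edge_weight A B false = 1.
Proof.
move=> [_ A1] [_ B1]; rewrite /edge_weight -big_split /= -[RHS]A1.
apply: eq_bigr => u _; rewrite -big_split /= -[RHS]mulr1 -B1 mulr_sumr.
by apply: eq_bigr => v _; case: adj; rewrite /= ?addr0 ?add0r.
Qed.

Let ts_edge_weight A B b : weighted A -> weighted B -> ts B A b ->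
  (1 - eps) ^+ 2 <= edge_weight A B b.
Proof.
move: eps_bounds => /andP[e0 e1] wA wB tsBA; rewrite edge_weightC.
have e2 : 0 <= 1 - eps by lra.
apply: (@le_trans _ _ (\sum_(v <- finsupp B | tv A v b) B v * (1 - eps))).
  by rewrite -mulr_suml expr2 ler_wpM2r.
rewrite /edge_weight big_mkcond; apply: ler_sum => v _.
case: ifP => [tvA|_]; last first.
  by apply: sumr_ge0 => u _; case: ifP => // _; rewrite mulr_ge0 ?weighted_ge0.
rewrite -big_mkcond -mulr_sumr ler_wpM2l ?weighted_ge0//.
by under eq_bigl do rewrite adj_sym.
Qed.

Lemma ts_sym A B b : eps_vertex A -> eps_vertex B -> ts A B b -> ts B A b.
Proof.
move: eps_bounds => /andP[e0 e1] [[wA gA] xA] [[wB gB] xB] tsAB.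
have neg c : ts B A c -> ts A B (~~ c) -> False.
  move=> /(ts_edge_weight wA wB) h1 /(ts_edge_weight wB wA).
  rewrite edge_weightC => h2; have := edge_weight_sum wA wB.
  by case: c h1 h2 => /= h1 h2 h3; nra.
by have [|] := xB A (conj wA gA) => h; case: b tsAB => // /(neg _ h).
Qed.

End Fixed.

Section Step.
Hypothesis eps_bounds : 0 < eps < 1 / 4.
Variables (G : graph) (W : representatives G).

Definition ext_vertex : choiceType := (G + W)%type.

(* A vertex v of [G] is identified with {(v, 1)}. *)
Definition ext_wset (x : ext_vertex) : wset G :=
  match x with inl v => point v | inr B => set_val B end.

Definition ext_adj : rel ext_vertex := fun x y =>
  match x, y with
  | inl v, inl w => adj v w
  | _, _ => ts (ext_wset x) (ext_wset y) true
  end.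

Lemma ext_wset_eps_vertex x : eps_vertex (ext_wset x).
Proof.
case: x => [v|B] /=; first by apply: point_eps_vertex; case/andP: eps_bounds.
by apply: (@rep_eps_vertex _ W); apply: set_valP.
Qed.

Lemma ext_adj_sym : symmetric ext_adj.
Proof.
have tsC x y :
    ts (ext_wset x) (ext_wset y) true = ts (ext_wset y) (ext_wset x) true.
  by apply/idP/idP; apply: ts_sym => //; exact: ext_wset_eps_vertex.
by move=> [v|B] [w|C]; [exact: adj_sym|exact: tsC..].
Qed.

Definition extension : graph := Graph ext_adj_sym.

End Step.

Section Saturation.
Hypothesis eps_bounds : 0 < eps < 1 / 4.
Variables (G : graph) (W : nat -> forall H : graph, representatives H).

(* Only the values [W n (level n)] matter; [W] is defined on all graphs so that
   the recursion can be written. *)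
Fixpoint level (n : nat) : graph :=
  if n is n'.+1 then extension eps_bounds (W n' (level n')) else G.

(* The increasing union of the V_n: every vertex either is in V_0 or is added at
   a unique step.  [incl n] is the inclusion of V_n. *)
Definition sat_vertex : choiceType := (G + {n : nat & W n (level n)})%type.

Fixpoint incl (n : nat) : level n -> sat_vertex :=
  match n with
  | 0 => fun v => inl v
  | n'.+1 => fun x : level n'.+1 =>
      match x with
      | inl v => incl v
      | inr B => inr (existT _ n' B)
      end
  end.

Definition sat_adj : rel sat_vertex := fun p q =>
  `[< exists n (x y : level n), [/\ incl x = p, incl y = q & adj x y] >].

Lemma sat_adj_sym : symmetric sat_adj.
Proof.
by move=> p q; apply/asboolP/asboolP => -[n [x [y [xp yq xy]]]];
  exists n, y, x; rewrite adj_sym.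
Qed.

Definition saturation : graph := Graph sat_adj_sym.

End Saturation.
End WeightedSets.

(* Main.v *)
Require Import Defs.
From HB Require Import structures.
From mathcomp Require Import all_boot all_order all_algebra finmap.
From mathcomp Require Import all_classical all_reals ereal.
From mathcomp Require Import lra zify.

Import Order.TTheory GRing.Theory Num.Theory.

Local Open Scope ring_scope.

(** Each new vertex of a saturation step is a weighted set of old vertices, and
its answer to an adjacency question is shared by all but weight [eps] of its
members.  So if a vertex of the extension answers fewer than [1 / eps]
questions in a given way, the exceptional weights do not add up to 1, and one
of its members answers all of them in the same way.  Applied first to the
vertices on one side of a finite bipartite adjacency pattern and then to those
on the other side, this moves every small pattern from the extension down to
the old graph ([realizable_extension]).  A pattern in the saturation involves
finitely many vertices, hence lies in some level, and descends to the original
graph ([realizable_saturation]); conversely the original graph is an induced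
subgraph of the saturation ([saturation_realizable]).

A Littlestone tree of height [m], a half graph of length [m] and a shattered
set of size [m] are patterns with [2 ^ m], [m] and [2 ^ m] vertices on one side
and, for each of these, [m] conditions.  For the Littlestone and VC dimensions
it suffices to exclude the value [l + 1] in the saturation, since the
configurations of these two kinds can be shrunk ([bounded_transfer]), and the
bound [eps < 1 / 2 ^ (l + 1)] is just what makes such patterns small.  For
thresholds, binary search turns a half graph of length [2 ^ (l + 1)] into a
Littlestone tree of height [l + 1] ([threshold_tree]); hence half graphs in the
saturation, whose Littlestone dimension is now known to be [l], are shorter
than that and descend too. *)

Set Implicit Arguments.
Unset Strict Implicit.
Unset Printing Implicit Defensive.

(** * Finite adjacency patterns *)

(** The conditions are restricted to [j \in c i] because a node of a Littlestone
tree constrains only the leaves below it. *)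
Definition realizable (G : graph) (I : finType) (J : eqType)
    (c : I -> seq J) (b : I -> J -> bool) : Prop :=
  exists (h : I -> G) (x : J -> G),
    forall i j, j \in c i -> adj (h i) (x j) = b i j.

(** * Descending one step *)

(** Induction on [s], by inclusion-exclusion for two events in a space of total
mass 1. *)
Lemma union_bound (R : realType) (eps : R) (G : graph) (A : wset R G)
    (T : eqType) (P : T -> pred G) (s : seq T) :
    weighted A ->
    (forall t, t \in s -> 1 - eps <= \sum_(u <- finsupp A | P t u) A u) ->
  1 - (size s)%:R * eps <=
    \sum_(u <- finsupp A | all (fun t => P t u) s) A u.
Proof.
move=> wA; elim: s => [|t s IHs] Ps /=.
  by rewrite mul0r subr0 wA.2.
have {}IHs := IHs (fun t' t's => Ps t' (mem_behead (s := t :: s) t's)).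
have Pt := Ps t (mem_head _ _).
set F := fun u => all (fun t' => P t' u) s in IHs *.
have UB : \sum_(u <- finsupp A | P t u) A u +
    \sum_(u <- finsupp A | F u) A u <=
    1 + \sum_(u <- finsupp A | P t u && F u) A u.
  rewrite -{1}wA.2 [X in X + _ <= _]big_mkcond [X in _ + X <= _]big_mkcond.
  rewrite [X in _ <= _ + X]big_mkcond -!big_split /=.
  apply: ler_sum => u _; have := weighted_ge0 u wA.
  by case: (P t u); case: (F u) => /=; lra.
rewrite -natr1 mulrDl mul1r; lra.
Qed.

Lemma select (R : realType) (eps : R) (G : graph) (A : wset R G)
    (T : eqType) (P : T -> pred G) (s : seq T) :
    weighted A -> (size s)%:R * eps < 1 ->
    (forall t, t \in s -> 1 - eps <= \sum_(u <- finsupp A | P t u) A u) ->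
  exists u, forall t, t \in s -> P t u.
Proof.
move=> wA es Ps; have := union_bound wA Ps.
have [/hasP[u _ /allP Pu] _|/hasPn none] :=
  boolP (has (fun u => all (fun t => P t u) s) (finsupp A)).
  by exists u.
rewrite big_seq_cond big_pred0 => [|u]; first lra.
by case: (boolP (u \in finsupp A)) => // /none/negbTE ->.
Qed.

Section Step.
Variables (R : realType) (eps : R) (eps_bounds : 0 < eps < 1 / 4).

Lemma ts_point (G : graph) (v : G) (A : wset R G) (b : bool) :
  ts eps (Defs.point R v) A b = tv eps A v b.
Proof.
move: eps_bounds => /andP[e0 e1].
rewrite /ts big_mkcond finsupp_point big_seq_fset1 pointE.
by case: (tv eps A v b); [apply/idP; lra|apply/negbTE; rewrite -ltNge; lra].
Qed.

Lemma tv_point (G : graph) (u v : G) (b : bool) :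
  tv eps (Defs.point R u) v b = (adj u v == b).
Proof.
move: eps_bounds => /andP[e0 e1].
rewrite /tv big_mkcond finsupp_point big_seq_fset1 pointE.
by case: (adj u v == b); [apply/idP; lra|apply/negbTE; rewrite -ltNge; lra].
Qed.

(** Non-adjacency gives more than the failure of [ts _ _ true]: excellence
turns it into a majority for [false]. *)
Lemma ext_adj_ts (G : graph) (W : representatives eps G)
    (x y : extension eps_bounds W) (b : bool) :
  adj x y = b -> ts eps (ext_wset x) (ext_wset y) b.
Proof.
have E : adj x y = ts eps (ext_wset x) (ext_wset y) true.
  by case: x y => [v|B] [w|C] //=; rewrite ts_point tv_point eqb_id adj_sym.
rewrite E; case: b => // tF.
have [_ xX] := ext_wset_eps_vertex eps_bounds x.
by have [gY _] := ext_wset_eps_vertex eps_bounds y; have [|//] := xX _ gY;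
  rewrite tF.
Qed.

(** Two replacements, the second made against the vertices of [G] found by the
first: [h' i] answers the [size (c i)] questions of its row as [h i] does, and
then [x' j] answers its at most [#|I|] questions about the [h' i]. *)
Lemma realizable_extension (G : graph) (W : representatives eps G)
    (I : finType) (J : eqType) (c : I -> seq J) (b : I -> J -> bool) :
    #|I|%:R * eps < 1 -> (forall i, (size (c i))%:R * eps < 1) ->
  realizable (extension eps_bounds W) c b -> realizable G c b.
Proof.
move=> eI ec [h [x hx]].
have wE z : weighted (@ext_wset _ eps _ W z).
  by case: (ext_wset_eps_vertex eps_bounds z) => [[]].
(* [h' i] still faces the weighted sets [x j], not vertices of [G]. *)
have /choice[h' h'P] i : exists v : G, forall j, j \in c i ->
    tv eps (ext_wset (x j)) v (b i j).
  apply: (@select _ eps _ (ext_wset (h i)) _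
    (fun j u => tv eps (ext_wset (x j)) u (b i j))) => // j cij.
  exact/ext_adj_ts/hx.
have /choice[x' x'P] j : exists u : G, forall i, j \in c i ->
    adj u (h' i) == b i j.
  have [||u uP] := @select _ eps _ (ext_wset (x j)) _
    (fun i u => adj u (h' i) == b i j) [seq i <- enum I | j \in c i] (wE _).
  - apply: le_lt_trans eI; case/andP: eps_bounds => e0 _.
    by rewrite ler_pM2r // ler_nat cardE size_filter count_size.
  - by move=> i; rewrite mem_filter => /andP[cij _]; exact: h'P.
  by exists u => i cij; apply: uP; rewrite mem_filter cij mem_enum.
by exists h', x' => i j cij; rewrite adj_sym; apply/eqP/x'P.
Qed.

End Step.

(** * The union of the levels *)

Section Union.
Variables (R : realType) (eps : R) (eps_bounds : 0 < eps < 1 / 4).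
Variables (G : graph) (W : nat -> forall H : graph, representatives eps H).

Local Notation lev := (level eps_bounds G W).
Local Notation sat := (saturation eps_bounds G W).
Local Notation inc n := (@Defs.incl R eps eps_bounds G W n).

(** A vertex remembers the step at which it was added, so it cannot occur in
earlier levels. *)
Lemma incl_new_lt n (v : lev n) k (B : W k (lev k)) :
  inc n v = inr (existT _ k B) -> (k < n)%N.
Proof.
elim: n v => [//|n IHn] [v|C] /=; first by move/IHn/leqW.
by move=> [nk _]; rewrite -nk.
Qed.

Lemma incl_inj n : injective (inc n).
Proof.
elim: n => [|n IHn] /=; first by move=> v w [].
move=> [v|B] [w|C] /=.
- by move/IHn => ->.
- by move/incl_new_lt; rewrite ltnn.
- by move/esym/incl_new_lt; rewrite ltnn.
move=> [E]; congr inr.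
by apply: Eqdep_dec.inj_pair2_eq_dec E; exact: eq_comparable.
Qed.

Lemma level_embed n m : (n <= m)%N -> exists f : lev n -> lev m,
  (forall v, inc m (f v) = inc n v) /\ (forall v w, adj (f v) (f w) = adj v w).
Proof.
elim: m => [|m IHm]; first by rewrite leqn0 => /eqP ->; exists id.
rewrite leq_eqVlt => /predU1P[-> | ]; first by exists id.
rewrite ltnS => /IHm[f [fi fa]].
by exists (fun v => inl (f v) : lev m.+1).
Qed.

(** Adjacency in the union is witnessed at an unknown level [k]; both pairs of
vertices are compared at the later of the levels [n] and [k]. *)
Lemma adj_incl n (v w : lev n) : adj (inc n v : sat) (inc n w) = adj v w.
Proof.
apply/asboolP/idP => [[k [x [y [xv yw xy]]]]|vw]; last by exists n, v, w.
have [f [fi fa]] := level_embed (leq_maxl n k).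
have [g [gi ga]] := level_embed (leq_maxr n k).
have fg : f v = g x by apply: incl_inj; rewrite fi gi.
have fg' : f w = g y by apply: incl_inj; rewrite fi gi.
by rewrite -(fa v w) fg fg' ga.
Qed.

Lemma seq_in_level (s : seq sat) :
  exists n, forall p, p \in s -> exists v : lev n, inc n v = p.
Proof.
elim: s => [|p s [n IHs]]; first by exists 0%N.
have [k [w wp]] : exists k (w : lev k), inc k w = p.
  by case: p => [v|[k B]]; [exists 0%N, v|exists k.+1, (inr B)].
have [f [fi _]] := level_embed (leq_maxl n k).
have [g [gi _]] := level_embed (leq_maxr n k).
exists (maxn n k) => q; rewrite inE => /predU1P[->|/IHs[v <-]].
  by exists (g w); rewrite gi.
by exists (f v); rewrite fi.
Qed.

Lemma realizable_level n (I : finType) (J : eqType) (c : I -> seq J)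
    (b : I -> J -> bool) :
    #|I|%:R * eps < 1 -> (forall i, (size (c i))%:R * eps < 1) ->
  realizable (lev n) c b -> realizable G c b.
Proof.
by move=> eI ec; elim: n => [//|n IHn] /= /realizable_extension h; apply/IHn/h.
Qed.

(** The index [i0] supplies a value at level [n] for the vertices [x j] on which
there is no condition, as these need not occur at that level. *)
Lemma realizable_saturation (I : finType) (J : eqType) (c : I -> seq J)
    (b : I -> J -> bool) :
    I -> #|I|%:R * eps < 1 -> (forall i, (size (c i))%:R * eps < 1) ->
  realizable sat c b -> realizable G c b.
Proof.
move=> i0 eI ec [h [x hx]].
have [n lv] := seq_in_level
  (map h (enum I) ++ map x (flatten (map c (enum I)))).
apply: (@realizable_level n) => //.
have /choice[h' h'P] i : exists v : lev n, inc n v = h i.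
  by apply: lv; rewrite mem_cat map_f ?mem_enum.
have /choice[x' x'P] j : exists v : lev n,
    forall i, j \in c i -> inc n v = x j.
  have [[i cij]|no] := pselect (exists i, j \in c i).
    have [|v vP] := lv (x j); last by exists v.
    rewrite mem_cat orbC map_f //; apply/flatten_mapP.
    by exists i; rewrite ?mem_enum.
  by exists (h' i0) => i cij; case: no; exists i.
by exists h', x' => i j cij; rewrite -adj_incl h'P (x'P _ _ cij) hx.
Qed.

Lemma saturation_realizable (I : finType) (J : eqType) (c : I -> seq J)
    (b : I -> J -> bool) : realizable G c b -> realizable sat c b.
Proof.
move=> [h [x hx]]; exists (inc 0 \o h), (inc 0 \o x) => i j cij.
by rewrite -(hx i j cij) -(@adj_incl 0).
Qed.

End Union.

(** * The three dimensions as patterns *)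

Definition has_tree (G : graph) (m : nat) : Prop :=
  exists x, @littlestone_tree G m x.

Definition has_threshold (G : graph) (m : nat) : Prop :=
  exists x h : 'I_m -> G, forall i j : 'I_m, adj (h i) (x j) = (i < j)%N.

Definition has_shattered (G : graph) (m : nat) : Prop :=
  exists2 S : {fset G}, #|` S|%fset = m & shatters (range (@nbhd G)) S.

(** A node is a sequence [s] of directions, and a branch [y] through it goes in
the direction [y_(size s)]. *)
Lemma tree_realizable (G : graph) (m : nat) :
  has_tree G m <->
  realizable G (fun y : m.-tuple bool => [seq take i y | i <- iota 0 m])
    (fun y s => nth false y (size s)).
Proof.
split=> [[x /choice[h hx]]|[h [x hx]]].
  exists h, x => y s /mapP[i]; rewrite mem_iota add0n => /= im ->.
  rewrite size_takel ?size_tuple 1?ltnW// (hx y (Ordinal im)).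
  exact: tnth_nth.
exists x => y; exists (h y) => i; rewrite hx.
  by rewrite size_takel ?size_tuple 1?ltnW// (tnth_nth false).
by apply/mapP; exists (i : nat); rewrite ?mem_iota ?add0n ?ltn_ord.
Qed.

Lemma threshold_realizable (G : graph) (m : nat) :
  has_threshold G m <->
  realizable G (fun _ : 'I_m => enum 'I_m) (fun i j => (i < j)%N).
Proof.
split=> [[x [h hx]]|[h [x hx]]]; first by exists h, x => i j _; exact: hx.
by exists x, h => i j; rewrite hx ?mem_enum.
Qed.

Lemma shattered_realizable (G : graph) (m : nat) :
  has_shattered G m <->
  realizable G (fun _ : {set 'I_m} => enum 'I_m) (fun T j => j \in T).
Proof.
split=> [[S Sm shS]|[h [x hx]]].
  have Sm' : size (enum_fset S) = m by [].
  pose x (j : 'I_m) : G := tnth (Tuple (introT eqP Sm')) j.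
  have xS j : x j \in S by exact: mem_tnth.
  have xI : injective x by exact/tuple_uniqP/fset_uniq.
  have /choice[h hP] (T : {set 'I_m}) :
      exists v : G, forall j, adj v (x j) = (j \in T).
    have [|_ [v _ <-] vT] := shS [fset x j | j in T]%fset.
      by apply/fsubsetP => _ /imfsetP[j _ ->].
    exists v => j; apply/idP/idP => [vj|jT].
      have : ([set` S] `&` nbhd v)%classic (x j) by split; [exact: xS|].
      by rewrite vT => /imfsetP[k /= kT /xI ->].
    have : [set` [fset x k | k in T]%fset]%classic (x j).
      by rewrite /mkset; apply/imfsetP; exists j.
    by rewrite -vT => -[].
  by exists h, x => T j _; exact: hP.
have {}hx T j : adj (h T) (x j) = (j \in T) by apply: hx; rewrite mem_enum.
have xI : injective x.
  (* The pattern of the set [{i}] separates [x i] from the other [x j]. *)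
  by move=> i j xij; have := hx [set i] i; rewrite xij hx !inE eqxx => /eqP.
exists [fset x j | j in 'I_m]%fset.
  by rewrite card_imfset //= size_enum_ord.
move=> T TS; exists (nbhd (h [set j | x j \in T])).
  by exists (h [set j | x j \in T]).
apply/seteqP; split=> u; rewrite /nbhd /mkset /=.
  by move=> [/imfsetP[j _ ->]]; rewrite hx inE.
move=> uT; have /imfsetP[j _ uE] := fsubsetP TS u uT; split.
  by apply: (fsubsetP TS).
by rewrite uE hx inE -uE.
Qed.

Lemma has_tree_le (G : graph) (m n : nat) :
  (n <= m)%N -> has_tree G m -> has_tree G n.
Proof.
move=> nm [x xP]; exists x => y.
have sz : size (y ++ nseq (m - n) false) == m.
  by rewrite size_cat size_nseq size_tuple subnKC.
have [v vP] := xP (Tuple sz); exists v => i.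
have := vP (widen_ord nm i).
rewrite !(tnth_nth false) /= nth_cat size_tuple ltn_ord => <-.
by rewrite takel_cat // size_tuple ltnW.
Qed.

Lemma has_shattered_le (G : graph) (m n : nat) :
  (n <= m)%N -> has_shattered G m -> has_shattered G n.
Proof.
move=> nm /shattered_realizable[h [x hx]]; apply/shattered_realizable.
exists (fun T : {set 'I_n} => h (widen_ord nm @: T)), (x \o widen_ord nm).
move=> T j _ /=.
rewrite hx ?mem_enum // mem_imset // => i k /(congr1 val) /= ik.
exact: val_inj.
Qed.

(** * Binary search *)

(** Left end of the interval of numbers below [2 ^ k] to which the binary search
has narrowed down after the answers [s], where [true] means the lower half.
For [size s = k] it is the position found. *)
Fixpoint search_lo (k : nat) (s : seq bool) : nat :=
  match k, s with
  | k'.+1, b :: s' => ((~~ b) * 2 ^ k' + search_lo k' s')%N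
  | _, _ => 0%N
  end.

Lemma search_lo_lt k s : (search_lo k s < 2 ^ k)%N.
Proof.
elim: k s => [|k IHk] [|b s] //=; rewrite ?expn_gt0 //.
by have := IHk s; rewrite expnS; case: b => /=; lia.
Qed.

(** The final position is compared with the midpoint of the interval reached
after [i] answers, which is what answer number [i] decides. *)
Lemma search_lo_take k y i : size y = k -> (i < k)%N ->
  (search_lo k y < search_lo k (take i y) + 2 ^ (k - i.+1))%N = nth false y i.
Proof.
elim: k y i => [//|k IHk] [//|b y] [|i] /= [sz] ik.
  by rewrite subSS subn0; have := search_lo_lt k y; case: b => /=; lia.
by rewrite -addnA ltn_add2l subSS IHk.
Qed.

Lemma search_mid_lt k s : (size s < k)%N ->
  (search_lo k s + 2 ^ (k - (size s).+1) < 2 ^ k)%N.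
Proof.
elim: k s => [//|k IHk] [|b s] /=.
  by rewrite subSS subn0 expnS; have := expn_gt0 2 k; lia.
by rewrite subSS expnS => /IHk; case: b => /=; lia.
Qed.

(** The node [s] is labelled by the midpoint queried after the answers [s], and
the leaf [y] by the position that the search finds.  All midpoints are below
[2 ^ k], so a half graph of length [2 ^ k] has enough vertices. *)
Lemma threshold_tree (G : graph) (m k : nat) :
  (2 ^ k <= m)%N -> has_threshold G m -> has_tree G k.
Proof.
case: m => [|m]; first by have := expn_gt0 2 k; lia.
move=> km [x [h hx]].
exists (fun s => x (inord (search_lo k s + 2 ^ (k - (size s).+1)))) => y.
exists (h (inord (search_lo k y))) => i.
have sz : size (take i y) = i by rewrite size_takel // size_tuple ltnW.
rewrite hx !inordK.
- by rewrite sz search_lo_take ?size_tuple // (tnth_nth false).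
- by apply: leq_trans km; apply: search_mid_lt; rewrite sz.
exact: leq_trans (search_lo_lt _ _) km.
Qed.

(** * Comparing greatest elements *)

Lemma greatest_le (R : realType) (P : set nat) (l m : nat) :
  greatest R P = (l%:R)%:E -> P m -> (m <= l)%N.
Proof.
move=> Pl Pm; rewrite -(ler_nat R) -lee_fin -Pl.
by apply: ereal_sup_ubound; exists m.
Qed.

(** If [Q] had an element above [l], it would also contain [l + 1] by downward
closure, and then so would [P], against the choice of [l]. *)
Lemma bounded_transfer (R : realType) (P Q : set nat) (l : nat) :
    greatest R P = (l%:R)%:E ->
    (forall m, P m -> Q m) ->
    (forall m, (m <= l.+1)%N -> Q m -> P m) ->
    (forall m n, (n <= m)%N -> Q m -> Q n) ->
  P = Q.
Proof.
move=> Pl PQ QP Qle; apply/seteqP; split=> m; first exact: PQ.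
move=> Qm; apply: (QP) => //; rewrite leqNgt; apply/negP => /ltnW lm.
by have /(greatest_le Pl) := QP _ (leqnn _) (Qle _ _ lm Qm); rewrite ltnn.
Qed.

Lemma pow2_eps (R : realType) (eps : R) (l m : nat) :
  0 < eps -> eps < 1 / 2 ^+ l.+1 -> (m <= 2 ^ l.+1)%N -> m%:R * eps < 1.
Proof.
move=> e0; rewrite ltr_pdivlMr ?exprn_gt0 // => el ml.
apply: le_lt_trans el; rewrite mulrC ler_pM2l //.
by rewrite -natrX ler_nat.
Qed.

Unset Implicit Arguments.

(** * The theorem *)

Theorem mainTheorem6 (R : realType) (G : graph) (eps : R)
    (eps_bounds : 0 < eps < 1 / 4)
    (W : nat -> forall H : graph, representatives eps H) :
  (forall l : nat, Ldim R G = (l%:R)%:E -> eps < 1 / 2 ^+ l.+1 ->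
     (Ldim R G = Ldim R (saturation eps_bounds G W) /\
      Ldim R (saturation eps_bounds G W) = (l%:R)%:E) /\
     (eps < 1 / 2 ^+ l.+2 -> Thr R G = Thr R (saturation eps_bounds G W))) /\
  (forall d : nat, VC R G = (d%:R)%:E -> eps < 1 / 2 ^+ d.+1 ->
     VC R G = VC R (saturation eps_bounds G W)).
Proof.
have e0 : 0 < eps by case/andP: eps_bounds.
set S := saturation eps_bounds G W.
split=> [l Gl el|d Gd ed].
  have treeE : has_tree G = has_tree S.
    apply: (bounded_transfer Gl) => [m|m ml|m n].
    - by move=> /tree_realizable t; apply/tree_realizable/saturation_realizable.
    - have ml2 : (2 ^ m <= 2 ^ l.+1)%N by rewrite leq_exp2l.
      move/tree_realizable/realizable_saturation => h.
      apply/tree_realizable/h => [||y]; first exact: [tuple of nseq m false].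
        by apply: pow2_eps el _; rewrite // card_tuple card_bool.
      apply: pow2_eps el _; rewrite // size_map size_iota.
      exact/(leq_trans _ ml2)/ltnW/ltn_expl.
    - exact: has_tree_le.
  have LE : Ldim R S = (l%:R)%:E.
    by rewrite -Gl; exact: (congr1 (greatest R) (esym treeE)).
  split; first by rewrite Gl LE.
  move=> _; suff tE : has_threshold G = has_threshold S.
    by exact: (congr1 (greatest R) tE).
  apply/seteqP; split=> m.
    move=> /threshold_realizable t.
    by apply/threshold_realizable/saturation_realizable.
  move=> thm; have ml : (m <= 2 ^ l.+1)%N.
    rewrite leqNgt; apply/negP => /ltnW /threshold_tree /(_ thm) t.
    by have := greatest_le LE t; rewrite ltnn.
  (* Without indices there is no [i0] for [realizable_saturation]. *)
  case: m => [|m] in thm ml *.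
    have x : 'I_0 -> G by case.
    by exists x, x; case.
  move: thm => /threshold_realizable/realizable_saturation h.
  apply/threshold_realizable/h => [||y]; first exact: ord0.
    by apply: pow2_eps el _; rewrite // card_ord.
  by apply: pow2_eps el _; rewrite // size_enum_ord.
suff sE : has_shattered G = has_shattered S by exact: (congr1 (greatest R) sE).
apply: (bounded_transfer Gd) => [m|m md|m n].
- move=> /shattered_realizable t.
  by apply/shattered_realizable/saturation_realizable.
- have md2 : (2 ^ m <= 2 ^ d.+1)%N by rewrite leq_exp2l.
  move/shattered_realizable/realizable_saturation => h.
  apply/shattered_realizable/h => [||T]; first exact: finset.set0.
    by apply: pow2_eps ed _;
    rewrite // -cardsT -powersetT card_powerset cardsT card_ord.
  apply: pow2_eps ed _; rewrite // size_enum_ord.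
  exact/(leq_trans _ md2)/ltnW/ltn_expl.
- exact: has_shattered_le.
Qed.
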